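(* Let $m>0$ and $k\ge 0$ be integers. Then $$(R_mC_mR_m)^k=R_mC_m^k .$$
   Context: For an integer $m>0$, $C_m$ is the $m\times m$ circulant matrix whose $(i,j)$ entry ($0\le i,j\le m-1$) is the residue of $i-j$ modulo $m$ in $\{0,1,\dots,m-1\}$; so its first row is $(0,m-1,m-2,\dots,2,1)$, its first column is $(0,1,\dots,m-1)^T$, and each row is the cyclic shift to the right of the preceding one. $R_m$ is the $m\times m$ matrix given in block form by $$R_m=\begin{pmatrix} I_{m-1} & -\mathbf{1}\\ 0 & 0\end{pmatrix},$$ where $I_{m-1}$ is the identity matrix of size $m-1$, $\mathbf 1$ is the column vector of length $m-1$ with all entries $1$, and the last row is zero (for $m=1$, $R_1$ is the $1\times 1$ zero matrix).
   Formalization: The identity is stated for k > 0 instead of k ≥ 0: at k = 0, with the convention that the zeroth power is the identity matrix, it would read I = R_m, which is false for every m > 0 since the last row of R_m is zero. *)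

(* Defs.v *)
From HB Require Import structures.
From mathcomp Require Import all_boot all_order all_algebra.

Set Implicit Arguments.
Unset Strict Implicit.
Unset Printing Implicit Defensive.

Import Order.TTheory GRing.Theory Num.Theory.
Local Open Scope ring_scope.

(* The difference is taken in int: truncated subtraction on nat would give 0
   for all i <= j.  For m > 0, modz takes its values in {0, ..., m - 1}. *)
Definition Cmx (m : nat) : 'M[int]_m :=
  \matrix_(i < m, j < m) (((i : nat)%:Z - (j : nat)%:Z) %% m%:Z)%Z.

(* Given by its entries, so that the size is m itself and not (m.-1 + 1); the
   block form is Rmx_block. *)
Definition Rmx (m : nat) : 'M[int]_m :=
  \matrix_(i < m, j < m)
    if (i : nat) == m.-1 then 0
    else if (j : nat) == m.-1 then -1
    else (i == j)%:R.

Lemma Rmx_block (n : nat) :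
  Rmx (n + 1) = block_mx (1%:M : 'M_n) (const_mx (-1)) 0 0.
Proof.
have en : (n + 1).-1 = n by rewrite addn1.
apply/matrixP => i j; rewrite mxE en.
case: (split_ordP i) => i' ->; case: (split_ordP j) => j' ->;
  rewrite ?(block_mxEul, block_mxEur, block_mxEdl, block_mxEdr) !mxE /=;
  rewrite ?(ord1 i') ?(ord1 j') /= ?addn0 ?eqxx ?(ltn_eqF (ltn_ord _)) //.
Qed.

(* Main.v *)
Require Import Defs.
From mathcomp Require Import all_boot all_order all_algebra.

Import Order.TTheory GRing.Theory Num.Theory.
Local Open Scope ring_scope.

(** With [1] the all-ones column and [e] the last basis vector, [R = I - 1 e^T],
    and [R 1 = 0] since [e^T 1 = 1].  The rows of [C] are permutations of each
    other, so [C 1 = s 1] for some scalar [s]; hence [R C 1 = 0] and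
    [R C R = R C - (R C 1) e^T = R C].  The powers then telescope. *)

Lemma Rmx_rank1 (n : nat) :
  Rmx n.+1 = 1%:M - (const_mx 1 : 'cV_n.+1) *m delta_mx 0 ord_max.
Proof.
apply/matrixP => i j; rewrite !mxE big_ord1 !mxE mul1r /=.
rewrite -[(j : nat) == n]/(j == ord_max) -[(i : nat) == n]/(i == ord_max).
have [->|i_neq] := eqVneq i ord_max.
  by rewrite (eq_sym ord_max j) subrr.
have [->|_] := eqVneq j ord_max; first by rewrite (negPf i_neq) sub0r.
by rewrite subr0.
Qed.

Lemma Rmx_const (n : nat) : Rmx n.+1 *m (const_mx 1 : 'cV_n.+1) = 0.
Proof.
rewrite Rmx_rank1 mulmxBl mul1mx -mulmxA -rowE row_const.
by apply/matrixP => i j; rewrite !mxE big_ord1 !mxE mulr1 subrr.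
Qed.

(** Reading the residue as subtraction in the cyclic group ['I_n.+1] turns the permutation of a row
    into the injectivity of [j] ↦ [i - j]. *)
Lemma CmxE (n : nat) (i j : 'I_n.+1) : Cmx n.+1 i j = ((i - j)%R : nat)%:Z.
Proof.
(* In ['I_n.+1], [- j] is computed from [n.+1 - j]; the extra [n.+1] vanishes modulo [n.+1]. *)
rewrite mxE /= modnDmr -modz_nat PoszD -subzn; last exact: ltnW.
by rewrite addrCA -modzDl.
Qed.

Lemma Cmx_const (n : nat) :
  Cmx n.+1 *m (const_mx 1 : 'cV_n.+1) =
  (\sum_(j < n.+1) (j : nat)%:Z) *: const_mx 1.
Proof.
apply/matrixP => i z; rewrite !mxE mulr1.
rewrite [RHS](reindex_inj (subrI i)) /=.
by apply: eq_bigr => j _; rewrite CmxE mxE mulr1.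
Qed.

Lemma Rmx_Cmx_Rmx (m : nat) : Rmx m *m Cmx m *m Rmx m = Rmx m *m Cmx m.
Proof.
case: m => [|n]; first by apply/matrixP => -[].
rewrite [X in _ *m X]Rmx_rank1 mulmxBr mulmx1 mulmxA -(mulmxA (Rmx _)).
by rewrite Cmx_const -scalemxAr Rmx_const scaler0 mul0mx subr0.
Qed.

Theorem mainTheorem6 (m k : nat) (hm : (0 < m)%N) (hk : (0 < k)%N) :
  (Rmx m *m Cmx m *m Rmx m) ^+ k = Rmx m *m (Cmx m ^+ k).
Proof.
(* The induction starts at exponent 1: at 0 the two sides would be the identity and [Rmx m], whose
   last row is zero. *)
rewrite Rmx_Cmx_Rmx; case: k hk => // k _.
elim: k => [|k IHk]; first by rewrite !expr1.
by rewrite exprS IHk -mulmxE mulmxA Rmx_Cmx_Rmx -mulmxA mulmxE -exprS.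
Qed.
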